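(* The modal logic $\mathsf{K4}$ is complete for finite transitive provability models with necessitation: if $A\in\mathcal L_\Box$ holds at every world of every provability model with finitely many worlds, transitive accessibility relation, and necessitation, then $\mathsf{K4}\vdash A$.
   Context: $\mathsf{K4}$ is $\mathsf K$ (the smallest normal modal logic) plus $\Box A\to\Box\Box A$. Language $\mathcal L_\Box$: formulas built from atomic propositions and $\bot$ using $\to$ and a unary $\Box$. A formula is purely modal if it is a Boolean combination of formulas $\Box B$. A theory is a pair of a set of axioms and a set of inference rules (finitely many premises, one conclusion); $\mathsf T\vdash A$ means derivability from axioms by rules. A theory is classical if modus ponens is one of its rules and all classical tautologies are derivable. A provability pre-model is $\mathcal P=(W,\sqsubset,\{L_w\}_{w\in W^\sqsubset},V)$ with $W$ nonempty, $\sqsubset$ a binary relation on $W$, $V\subseteq W\times\mathrm{atoms}$, $W^\sqsubset=\{u:\exists v\,(v\sqsubset u)\}$, and a theory $L_w$ for each $w\in W^\sqsubset$. Satisfaction: atoms via $V$, $\bot$ never holds, $\to$ classical, $\mathcal P,w\Vdash\Box A$ iff $L_u\vdash A$ for all $u$ with $w\sqsubset u$. With $\sqsubset^+$ the transitive closure, $\mathcal P,w\Vdash^+A$ iff there is $u\sqsubset w$ with $\mathcal P,v\Vdash A$ for all $v$ such that $u\sqsubset^+v$. A provability model is a pre-model in which every $L_w$ is classical and which satisfies modal completeness: for every $w\in W^\sqsubset$ and purely modal $A$, $\mathcal P,w\Vdash^+A$ implies $L_w\vdash A$. A provability model has necessitation if every $L_w$ has the rule ''from $A$ infer $\Box A$''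 among its rules. *)

(* Defs.v *)
From Stdlib Require Import List Relations.
Import ListNotations.

Inductive form : Type :=
| Atom (p : nat)
| Bot
| Imp (A B : form)
| Box (A : form).

Inductive purely_modal : form -> Prop :=
| pm_box B : purely_modal (Box B)
| pm_bot : purely_modal Bot
| pm_imp A B : purely_modal A -> purely_modal B -> purely_modal (Imp A B).

(* Tautologies of the modal language: the valuation [e] treats every atom and
   every boxed formula as a propositional variable. *)
Fixpoint bool_eval (e : form -> bool) (A : form) : bool :=
  match A with
  | Bot => false
  | Imp B C => implb (bool_eval e B) (bool_eval e C)
  | Atom _ | Box _ => e A
  end.

Definition tautology (A : form) : Prop :=
  forall e : form -> bool, bool_eval e A = true.

(* A rule is the set of its instances (finite list of premises, conclusion). *)
Definition rule : Type := list form -> form -> Prop.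

Definition modus_ponens : rule :=
  fun prems concl => exists A B, prems = [A; Imp A B] /\ concl = B.

Definition necessitation : rule :=
  fun prems concl => exists A, prems = [A] /\ concl = Box A.

Record theory : Type := Theory {
  axioms : form -> Prop;
  rules : rule -> Prop
}.

Inductive derivable (T : theory) : form -> Prop :=
| der_axiom A : axioms T A -> derivable T A
| der_rule (r : rule) prems concl :
    rules T r -> r prems concl ->
    (forall A, In A prems -> derivable T A) ->
    derivable T concl.

Definition classical (T : theory) : Prop :=
  rules T modus_ponens /\ forall A, tautology A -> derivable T A.

Inductive K4_axiom : form -> Prop :=
| K4_taut A : tautology A -> K4_axiom A
| K4_K A B : K4_axiom (Imp (Box (Imp A B)) (Imp (Box A) (Box B)))
| K4_4 A : K4_axiom (Imp (Box A) (Box (Box A))).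

Definition K4 : theory :=
  Theory K4_axiom (fun r => r = modus_ponens \/ r = necessitation).

(* [thy] is total for convenience: its values at worlds that are not
   [accessed] are never used below. *)
Record premodel : Type := Premodel {
  world : Type;
  world_inhabited : inhabited world;
  acc : relation world;
  thy : world -> theory;
  val : world -> nat -> Prop
}.

Definition accessed (P : premodel) (w : world P) : Prop :=
  exists v, acc P v w.

Fixpoint sat (P : premodel) (w : world P) (A : form) : Prop :=
  match A with
  | Atom p => val P w p
  | Bot => False
  | Imp B C => sat P w B -> sat P w C
  | Box B => forall u, acc P w u -> derivable (thy P u) B
  end.

Definition sat_plus (P : premodel) (w : world P) (A : form) : Prop :=
  exists u, acc P u w /\
    forall v, clos_trans (world P) (acc P) u v -> sat P v A.

Definition modally_complete (P : premodel) : Prop :=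
  forall w A, accessed P w -> purely_modal A ->
    sat_plus P w A -> derivable (thy P w) A.

Definition provability_model (P : premodel) : Prop :=
  (forall w, accessed P w -> classical (thy P w)) /\ modally_complete P.

Definition has_necessitation (P : premodel) : Prop :=
  forall w, accessed P w -> rules (thy P w) necessitation.

(* Main.v *)
Require Import Defs.
From Stdlib Require Import FinFun Relations.
From Stdlib Require Import Bool List Classical ClassicalEpsilon.
Import ListNotations.

(** A finite transitive Kripke model becomes a provability model with
    necessitation, with the same satisfaction relation, once [L_u] is taken to be
    the set of formulas true at [u] and at all successors of [u]: transitivity
    makes this set closed under necessitation, it makes [Box] agree with the
    Kripke box, and modal completeness is then immediate.  It remains to prove
    the finite model property of K4, by the canonical model whose worlds decide
    every subformula of the given formula. *)

(** * From Kripke models to provability models *)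

Fixpoint kripke_sat (W : Type) (R : relation W) (V : W -> nat -> Prop)
    (w : W) (A : form) : Prop :=
  match A with
  | Atom p => V w p
  | Bot => False
  | Imp B C => kripke_sat W R V w B -> kripke_sat W R V w C
  | Box B => forall u, R w u -> kripke_sat W R V u B
  end.

Section KripkeToProvability.

Variables (W : Type) (W_inh : inhabited W) (R : relation W) (V : W -> nat -> Prop).
Hypothesis R_trans : transitive W R.

(** Every formula true throughout the cone is an axiom. The two rules are listed because [classical]
    and [has_necessitation] ask for them; [derivable_cone_theory] shows that they derive nothing
    new. *)
Definition cone_theory (u : W) : theory :=
  Theory
    (fun B => kripke_sat W R V u B /\ forall v, R u v -> kripke_sat W R V v B)
    (fun r => r = modus_ponens \/ r = necessitation).

Definition kripke_premodel : premodel := Premodel W W_inh R cone_theory V.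

Lemma derivable_cone_theory u B :
  derivable (cone_theory u) B <->
  kripke_sat W R V u B /\ forall v, R u v -> kripke_sat W R V v B.
Proof.
  split; [|intros H; apply der_axiom; exact H].
  induction 1 as [B H|r prems B Hr Hi _ IH]; [exact H|].
  destruct Hr as [-> | ->].
  - destruct Hi as (C & D & -> & ->).
    destruct (IH C) as [HC HC']; [simpl; auto|].
    destruct (IH (Imp C D)) as [HD HD']; [simpl; auto|].
    split; [now apply HD|].
    intros v Hv. exact (HD' v Hv (HC' v Hv)).
  - destruct Hi as (C & -> & ->).
    destruct (IH C) as [HC HC']; [simpl; auto|].
    split; [exact HC'|].
    intros v Hv x Hx. apply HC'. now apply R_trans with v.
Qed.

Lemma kripke_premodel_sat B : forall w,
  sat kripke_premodel w B <-> kripke_sat W R V w B.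
Proof.
  induction B as [p| |B IHB C IHC|B _]; intros w; simpl.
  - reflexivity.
  - reflexivity.
  - now rewrite IHB, IHC.
  - split; intros H u Hu.
    + now apply derivable_cone_theory, H.
    (* Provability at [u] also demands [B] at the successors of [u], which are successors of [w] by
       transitivity. *)
    + apply derivable_cone_theory. split; [now apply H|].
      intros v Hv. apply H. now apply R_trans with u.
Qed.

(** Truth at [w], made Boolean by excluded middle, is itself a valuation of atoms and boxed
    formulas. *)
Lemma tautology_kripke_sat A w : tautology A -> kripke_sat W R V w A.
Proof.
  intros HA.
  set (e := fun B =>
    if excluded_middle_informative (kripke_sat W R V w B) then true else false).
  assert (He : forall B, bool_eval e B = true <-> kripke_sat W R V w B).
  { assert (e_iff : forall B, e B = true <-> kripke_sat W R V w B).
    { intros B. unfold e.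
      destruct (excluded_middle_informative (kripke_sat W R V w B));
        intuition discriminate. }
    induction B as [p| |B IHB C IHC|B _]; simpl bool_eval.
    - apply e_iff.
    - simpl; intuition discriminate.
    - simpl. rewrite <- IHB, <- IHC.
      destruct (bool_eval e B), (bool_eval e C); simpl; intuition.
    - apply e_iff. }
  now apply He.
Qed.

Lemma kripke_premodel_provability_model : provability_model kripke_premodel.
Proof.
  split.
  - intros w _. split; [now left|].
    intros B HB. apply derivable_cone_theory.
    split; [|intros v _]; now apply tautology_kripke_sat.
  - intros w B _ _ (u & Huw & Hu). apply derivable_cone_theory.
    (* The whole cone of [w] lies above its predecessor [u], where [B] is known to hold. *)
    assert (HB : forall v, R u v -> kripke_sat W R V v B).
    { intros v Hv. apply kripke_premodel_sat, Hu. now apply t_step. }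
    split; [now apply HB|].
    intros v Hv. apply HB. now apply R_trans with w.
Qed.

Lemma kripke_premodel_necessitation : has_necessitation kripke_premodel.
Proof. intros w _. now right. Qed.

End KripkeToProvability.

(** * Derivations in K4 *)

Definition Neg (B : form) : form := Imp B Bot.

(** Hypotheses are kept as antecedents of one formula, so that necessitation is applied to theorems
    only. *)
Definition imps (G : list form) (B : form) : form := fold_right Imp B G.

Lemma bool_eval_imps e G B :
  bool_eval e (imps G B) = true <->
  ((forall X, In X G -> bool_eval e X = true) -> bool_eval e B = true).
Proof.
  induction G as [|C G IH]; simpl.
  - intuition.
  - rewrite implb_true_iff, IH. split.
    + intros H HG. apply H; auto.
    + intros H HC HG. apply H. intros X [<-|HX]; auto.
Qed.

Lemma K4_mp B C :
  derivable K4 (Imp B C) -> derivable K4 B -> derivable K4 C.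
Proof.
  intros HBC HB.
  apply (der_rule K4 modus_ponens [B; Imp B C]); [now left|now exists B, C|].
  intros X [<-|[<-|[]]]; assumption.
Qed.

Lemma K4_nec B : derivable K4 B -> derivable K4 (Box B).
Proof.
  intros HB.
  apply (der_rule K4 necessitation [B]); [now right|now exists B|].
  intros X [<-|[]]; assumption.
Qed.

Lemma K4_tautological_consequence G B :
  (forall X, In X G -> derivable K4 X) ->
  (forall e, (forall X, In X G -> bool_eval e X = true) -> bool_eval e B = true) ->
  derivable K4 B.
Proof.
  intros HG HB.
  assert (H : derivable K4 (imps G B)).
  { apply der_axiom, K4_taut. intros e. apply bool_eval_imps, HB. }
  clear HB. induction G as [|C G IH]; [exact H|].
  apply IH; [intros X HX; apply HG; now right|].
  apply (K4_mp C); [exact H|]. apply HG. now left.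
Qed.

Lemma K4_cut G D B :
  (forall X, In X D -> derivable K4 (imps G X)) ->
  derivable K4 (imps D B) -> derivable K4 (imps G B).
Proof.
  intros HD HB.
  apply (K4_tautological_consequence (imps D B :: map (imps G) D)).
  - intros X [<-|HX]; [exact HB|].
    apply in_map_iff in HX as (Y & <- & HY). now apply HD.
  - intros e He. apply bool_eval_imps. intros HG.
    assert (H := He _ (or_introl eq_refl)).
    apply bool_eval_imps in H; [exact H|].
    intros X HX. assert (H' := He (imps G X) (or_intror (in_map _ _ _ HX))).
    now apply bool_eval_imps in H'.
Qed.

Lemma K4_imps_tautology G B :
  (forall e, (forall X, In X G -> bool_eval e X = true) -> bool_eval e B = true) ->
  derivable K4 (imps G B).
Proof.
  intros H. apply der_axiom, K4_taut. intros e. now apply bool_eval_imps, H.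
Qed.

Lemma K4_imps_in G B : In B G -> derivable K4 (imps G B).
Proof. intros HB. apply K4_imps_tautology. auto. Qed.

(** Necessitate the whole implication, then distribute the box over the antecedents one by one with
    axiom K. *)
Lemma K4_box_imps G B :
  derivable K4 (imps G B) -> derivable K4 (imps (map Box G) (Box B)).
Proof.
  intros H. apply K4_mp with (Box (imps G B)); [|now apply K4_nec].
  clear H. induction G as [|C G IH].
  - apply (K4_imps_in [Box B]). now left.
  - apply (K4_tautological_consequence
      [Imp (Box (Imp C (imps G B))) (Imp (Box C) (Box (imps G B)));
       Imp (Box (imps G B)) (imps (map Box G) (Box B))]).
    + intros X [<-|[<-|[]]]; [apply der_axiom, K4_K|exact IH].
    + intros e He.
      assert (H1 := He _ (or_introl eq_refl)).
      assert (H2 := He _ (or_intror (or_introl eq_refl))).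
      simpl in *. rewrite !implb_true_iff in *. auto.
Qed.

(** * Consistency *)

Definition consistent (G : list form) : Prop := ~ derivable K4 (imps G Bot).

Lemma consistent_contradiction G B :
  consistent G -> In B G -> In (Neg B) G -> False.
Proof.
  intros HG HB HN. apply HG. apply K4_imps_tautology. intros e He.
  assert (H := He _ HN). simpl in H. now rewrite (He _ HB) in H.
Qed.

Lemma consistent_incl G D : incl G D -> consistent D -> consistent G.
Proof.
  intros HGD HD HG. apply HD. apply K4_cut with G; [|exact HG].
  intros X HX. now apply K4_imps_in, HGD.
Qed.

Lemma not_derivable_consistent G B :
  ~ derivable K4 (imps G B) -> consistent (Neg B :: G).
Proof.
  intros H HN. apply H.
  apply (K4_tautological_consequence [imps (Neg B :: G) Bot]).
  - intros X [<-|[]]; exact HN.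
  - intros e He. assert (H' := He _ (or_introl eq_refl)). simpl in H'.
    rewrite implb_true_iff in H'. apply bool_eval_imps. intros HG.
    destruct (bool_eval e B); [reflexivity|].
    assert (H1 := H' eq_refl). rewrite bool_eval_imps in H1. now apply H1.
Qed.

(** If [G] proves [B], adding [B] is harmless by cut; otherwise [Neg B] can be added. *)
Lemma consistent_decide G B :
  consistent G -> consistent (B :: G) \/ consistent (Neg B :: G).
Proof.
  intros HG. destruct (classic (derivable K4 (imps G B))) as [HB|HB].
  - left. intros H. apply HG. apply K4_cut with (B :: G); [|exact H].
    intros X [<-|HX]; [exact HB|now apply K4_imps_in].
  - right. now apply not_derivable_consistent.
Qed.

(** * Finite canonical model *)

(** A world is one bit per formula of [Fs], which makes finiteness immediate. Inconsistent choices
    also belong to this type, so consistency is demanded separately wherever it matters. *)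
Fixpoint choices (Fs : list form) : Type :=
  match Fs with
  | [] => unit
  | _ :: Fs => bool * choices Fs
  end.

Fixpoint literals (Fs : list form) : choices Fs -> list form :=
  match Fs with
  | [] => fun _ => []
  | B :: Fs => fun w => (if fst w then B else Neg B) :: literals Fs (snd w)
  end.

Lemma choices_finite Fs : Finite (choices Fs).
Proof.
  induction Fs as [|B Fs [l Hl]]; simpl.
  - exists [tt]. intros []. now left.
  - exists (list_prod [true; false] l). intros [b w].
    apply in_prod; [destruct b; simpl; auto|apply Hl].
Qed.

Lemma literals_decide Fs : forall (w : choices Fs) B,
  In B Fs -> In B (literals Fs w) \/ In (Neg B) (literals Fs w).
Proof.
  induction Fs as [|C Fs IH]; intros w B HB; [destruct HB|].
  destruct w as [b w], HB as [<-|HB]; simpl.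
  - destruct b; auto.
  - destruct (IH w B HB); auto.
Qed.

(** A negative literal is an implication, so a boxed literal can only come from a positive
    choice. *)
Lemma box_literal Fs : forall (w : choices Fs) B,
  In (Box B) (literals Fs w) -> In (Box B) Fs.
Proof.
  induction Fs as [|C Fs IH]; intros w B; [now simpl|].
  destruct w as [b w]; simpl. intros [H|H]; [|right; now apply (IH w)].
  destruct b; [now left|discriminate H].
Qed.

(** Formulas are decided one at a time; [G] varies in the induction because each chosen literal
    joins it before the next decision. *)
Lemma lindenbaum Fs : forall G,
  consistent G -> exists w : choices Fs, consistent (literals Fs w ++ G).
Proof.
  induction Fs as [|B Fs IH]; intros G HG; [now exists tt|].
  assert (Hb : exists b : bool, consistent ((if b then B else Neg B) :: G)).
  { destruct (consistent_decide G B HG); [now exists true|now exists false]. }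
  destruct Hb as [b Hb]. destruct (IH _ Hb) as [w Hw].
  exists (b, w). eapply consistent_incl; [|exact Hw].
  simpl. intros X HX. rewrite in_app_iff in *. simpl in *.
  rewrite in_app_iff in HX. intuition.
Qed.

Section CanonicalModel.

Variable Fs : list form.
Hypothesis Fs_imp : forall B C, In (Imp B C) Fs -> In B Fs /\ In C Fs.
Hypothesis Fs_box : forall B, In (Box B) Fs -> In B Fs.

(** Passing on [Box B] together with [B] makes the relation transitive by construction. The first
    conjunct keeps inconsistent choices from being successors. *)
Definition canonical_acc (w v : choices Fs) : Prop :=
  consistent (literals Fs v) /\
  forall B, In (Box B) (literals Fs w) ->
    In B (literals Fs v) /\ In (Box B) (literals Fs v).

Definition canonical_val (w : choices Fs) (p : nat) : Prop :=
  In (Atom p) (literals Fs w).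

Lemma canonical_acc_trans : transitive _ canonical_acc.
Proof.
  intros w v u [_ Hv] [Cu Hu]. split; [exact Cu|].
  intros B HB. now apply Hu, Hv.
Qed.

Lemma literals_closed w B :
  consistent (literals Fs w) -> In B Fs ->
  derivable K4 (imps (literals Fs w) B) -> In B (literals Fs w).
Proof.
  intros Cw HB HD. destruct (literals_decide Fs w B HB) as [H|H]; [exact H|].
  destruct Cw. apply K4_cut with [B; Neg B].
  - intros X [<-|[<-|[]]]; [exact HD|now apply K4_imps_in].
  - apply K4_imps_tautology. intros e He.
    assert (H1 := He _ (or_introl eq_refl)).
    assert (H2 := He _ (or_intror (or_introl eq_refl))).
    simpl in H2. now rewrite H1 in H2.
Qed.

(** The choice must decide [B], and the negative decision would contradict [G]. *)
Lemma literals_extending G w B :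
  consistent (literals Fs w ++ G) -> In B Fs -> In B G -> In B (literals Fs w).
Proof.
  intros Cw HB HG. destruct (literals_decide Fs w B HB) as [H|H]; [exact H|].
  exfalso. apply (consistent_contradiction _ B Cw); apply in_or_app; auto.
Qed.

(** The successor extends [Neg B] together with all [C] and [Box C] such that [Box C] is in [w].
    Were this set inconsistent, boxing the derivation of [B] would put [Box B] into [w]. *)
Lemma canonical_existence w B :
  consistent (literals Fs w) -> In (Box B) Fs -> ~ In (Box B) (literals Fs w) ->
  exists v, canonical_acc w v /\ ~ In B (literals Fs v).
Proof.
  intros Cw HB HnB.
  set (G := flat_map
    (fun X => match X with Box C => [C; Box C] | _ => [] end) (literals Fs w)).
  assert (G_spec : forall X, In X G <->
    exists C, In (Box C) (literals Fs w) /\ (X = C \/ X = Box C)).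
  { intros X. unfold G. rewrite in_flat_map. split.
    - intros (Y & HY & HX). destruct Y as [p| |Y Z|C]; try now destruct HX.
      exists C. simpl in HX. intuition.
    - intros (C & HC & HX). exists (Box C). simpl. intuition. }
  assert (CG : consistent (Neg B :: G)).
  { apply not_derivable_consistent. intros HD. apply HnB.
    apply literals_closed; [exact Cw|exact HB|].
    apply K4_cut with (map Box G); [|now apply K4_box_imps].
    intros X HX. apply in_map_iff in HX as (Y & <- & HY).
    apply G_spec in HY as (C & HC & [-> | ->]); [now apply K4_imps_in|].
    (* A member [Box C] of [G] becomes [Box (Box C)] after boxing; axiom 4 recovers it from
       [Box C]. *)
    apply K4_cut with [Box C].
    - intros X [<-|[]]. now apply K4_imps_in.
    - apply der_axiom, K4_4. }
  destruct (lindenbaum Fs _ CG) as [v Hv].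
  exists v. split; [split|].
  - eapply consistent_incl; [|exact Hv]. apply incl_appl, incl_refl.
  (* Both [C] and [Box C] lie in [Fs], so [v] decides them, and it must agree with [G]. *)
  - intros C HC. assert (HS := box_literal Fs w C HC).
    split; apply (literals_extending (Neg B :: G)); auto; right; apply G_spec;
      exists C; auto.
  - intros H. apply (consistent_contradiction _ B Hv); apply in_or_app;
      [now left|right; now left].
Qed.

(** Truth lemma: implications use that literals are closed under consequence inside [Fs], and boxes
    use [canonical_existence]. *)
Lemma canonical_truth B : In B Fs -> forall w, consistent (literals Fs w) ->
  (kripke_sat _ canonical_acc canonical_val w B <-> In B (literals Fs w)).
Proof.
  induction B as [p| |B IHB C IHC|B IHB]; intros HS w Cw; simpl.
  - reflexivity.
  - split; [intros []|]. intros H. apply Cw. now apply K4_imps_in.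
  - destruct (Fs_imp B C HS) as [HB HC]. rewrite (IHB HB w Cw), (IHC HC w Cw).
    split.
    + intros H. apply literals_closed; [exact Cw|exact HS|].
      destruct (literals_decide Fs w B HB) as [H'|H'].
      * apply K4_imps_tautology. intros e He. simpl.
        rewrite (He _ (H H')). apply implb_true_r.
      * apply K4_imps_tautology. intros e He. simpl.
        assert (HN := He _ H'). simpl in HN.
        now destruct (bool_eval e B).
    + intros H H'. apply literals_closed; [exact Cw|exact HC|].
      apply K4_imps_tautology. intros e He.
      assert (HI := He _ H). simpl in HI. now rewrite (He _ H') in HI.
  - assert (HB := Fs_box B HS). split.
    + intros H. apply NNPP. intros HN.
      destruct (canonical_existence w B Cw HS HN) as (v & Hv & Hn).
      apply Hn, (IHB HB v (proj1 Hv)), H, Hv.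
    + intros H v Hv. apply (IHB HB v (proj1 Hv)). now apply Hv.
Qed.

End CanonicalModel.

(** * Subformulas and the finite model property *)

Fixpoint subformulas (A : form) : list form :=
  A :: match A with
       | Imp B C => subformulas B ++ subformulas C
       | Box B => subformulas B
       | _ => []
       end.

Lemma subformulas_refl A : In A (subformulas A).
Proof. destruct A; now left. Qed.

Lemma subformulas_imp A B C :
  In (Imp B C) (subformulas A) -> In B (subformulas A) /\ In C (subformulas A).
Proof.
  induction A as [p| |D IHD E IHE|D IHD]; simpl; rewrite ?in_app_iff.
  - intros [H|[]]; discriminate H.
  - intros [H|[]]; discriminate H.
  - intros [H|H].
    + injection H as -> ->. split; right; [left|right]; apply subformulas_refl.
    + tauto.
  - intros [H|H]; [discriminate H|tauto].
Qed.

Lemma subformulas_box A B :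
  In (Box B) (subformulas A) -> In B (subformulas A).
Proof.
  induction A as [p| |D IHD E IHE|D IHD]; simpl; rewrite ?in_app_iff.
  - intros [H|[]]; discriminate H.
  - intros [H|[]]; discriminate H.
  - intros [H|H]; [discriminate H|tauto].
  - intros [H|H]; [injection H as ->; right; apply subformulas_refl|tauto].
Qed.

Theorem K4_finite_model_property (A : form) :
  ~ derivable K4 A ->
  exists (W : Type) (R : relation W) (V : W -> nat -> Prop) (w : W),
    Finite W /\ transitive W R /\ ~ kripke_sat W R V w A.
Proof.
  intros HA. set (Fs := subformulas A).
  (* [Neg A] is only a seed and may lie outside [Fs]; it prevents [w] from choosing [A]
     positively. *)
  destruct (lindenbaum Fs [Neg A]) as [w Hw].
  { now apply (not_derivable_consistent [] A). }
  exists (choices Fs), (canonical_acc Fs), (canonical_val Fs), w.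
  split; [apply choices_finite|split; [apply canonical_acc_trans|]].
  rewrite (canonical_truth Fs (subformulas_imp A) (subformulas_box A)).
  - intros H. apply (consistent_contradiction _ A Hw); apply in_or_app;
      [now left|right; now left].
  - apply subformulas_refl.
  - eapply consistent_incl; [|exact Hw]. apply incl_appl, incl_refl.
Qed.

Theorem theorem3p9 (A : form) :
  (forall P : premodel,
      provability_model P ->
      Finite (world P) ->
      transitive (world P) (acc P) ->
      has_necessitation P ->
      forall w : world P, sat P w A) ->
  derivable K4 A.
Proof.
  intros HA. apply NNPP. intros HN.
  destruct (K4_finite_model_property A HN) as (W & R & V & w & Wfin & Rtr & Hw).
  (* The refuting world [w] also witnesses that the model is nonempty. *)
  apply Hw, (kripke_premodel_sat W (inhabits w) R V Rtr).
  apply HA.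
  - now apply kripke_premodel_provability_model.
  - exact Wfin.
  - exact Rtr.
  - apply kripke_premodel_necessitation.
Qed.
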